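(* Let $P_X\in\mathcal P(\mathcal X^n)$ and $P_{\hat S}\in\mathcal P(\mathcal S^k)$ be arbitrary, let $q_\Theta^*\in\Pi_\Theta$ and $q^*(\theta)=\prod_{i=1}^nq_\Theta^*(\theta_i)$. There exists a random joint source-channel code $\psi$ such that $$e_{\mathbf d}(\psi)\le\min_{P_{L|S}}\max_{\theta\in\mathcal T^n}\Big(\mathbb E\big[\exp\big(-|i_{X;Y_{q^*}}(X;Y)-\log L|^+\big)\,\big|\,\theta\big]+\mathbb E\big[(1-P_{\hat S}(\mathcal B_{\mathbf d}(S)))^L\big]\Big),$$ where the minimum is over conditional distributions $P_{L|S}$ of a positive-integer-valued random variable $L$ given $S$, and $(S,L,\hat S,X,Y)\sim P_S\times P_{L|S}\times P_{\hat S}\times P_X\times P_{Y|X,\Theta=\theta}$.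
   Context: Finite sets $\mathcal X,\mathcal Y,\mathcal T,\mathcal S$; channels $P_{\mathbb Y|\mathbb X,\Theta}$ with memoryless extension $P_{Y|X,\Theta}(y|x,\theta)=\prod_{i=1}^nP_{\mathbb Y|\mathbb X,\Theta}(y_i|x_i,\theta_i)$. Source $S\in\mathcal S^k$ i.i.d. with $P_S=P_{\mathbb S}^{\otimes k}$; distortion $d(s,\hat s)=\frac1k\sum_id_{\mathsf S}(s_i,\hat s_i)$, level $\mathbf d$; $\mathcal B_{\mathbf d}(s)=\{\hat s\in\mathcal S^k:d(s,\hat s)\le\mathbf d\}$. A deterministic joint source-channel code is a pair $(f,\varphi)$, $f:\mathcal S^k\to\mathcal X^n$, $\varphi:\mathcal Y^n\to\mathcal S^k$, with $e_{\mathbf d,\theta}(f,\varphi)=\sum_{s,y}\mathbb I\{d(s,\varphi(y))>\mathbf d\}P_S(s)P_{Y|X,\Theta}(y|f(s),\theta)$. A random code is a random pair $(F,\Phi)\sim\psi$ of such codes; $e_{\mathbf d,\theta}(\psi)=\mathbb E[e_{\mathbf d,\theta}(F,\Phi)]$ and $e_{\mathbf d}(\psi)=\max_{\theta\in\mathcal T^n}e_{\mathbf d,\theta}(\psi)$. $C=\max_{P_{\mathbb X}}\min_{q_\Theta}I(\mathbb X;\mathbb Y_{q_\Theta})$ (averaged channel $\sum_\theta q_\Theta(\theta)P_{\mathbb Y|\mathbb X,\Theta=\theta}$), and $\Pi_\Theta=\{q_\Theta\in\mathcal P(\mathcal T):\max_{P_{\mathbb X}}I(\mathbb X;\mathbb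 Y_{q_\Theta})=C\}$. $i_{X;Y_{q^*}}(x;y)=\log\frac{(q^*P_{Y|X,\Theta})(y|x)}{(P_Xq^*P_{Y|X,\Theta})(y)}$ where $(q^*P_{Y|X,\Theta})(y|x)=\sum_\theta q^*(\theta)P_{Y|X,\Theta}(y|x,\theta)$ and $(P_Xq^*P_{Y|X,\Theta})(y)=\sum_xP_X(x)(q^*P_{Y|X,\Theta})(y|x)$. $|a|^+=\max(a,0)$; $\log,\exp$ base 2. *)

(* Defs.v *)
From HB Require Import structures.
From mathcomp Require Import all_boot all_order all_algebra.
From mathcomp Require Import all_classical all_reals all_analysis.
Set Implicit Arguments. Unset Strict Implicit. Unset Printing Implicit Defensive.
Import Order.TTheory GRing.Theory Num.Theory numFieldNormedType.Exports.
Local Open Scope ring_scope.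
Local Open Scope classical_set_scope.

Section Defs.
Variable R : realType.

Definition log2 (x : R) : R := ln x / ln 2.
Definition exp2 (x : R) : R := expR (x * ln 2).
Definition pospart (a : R) : R := Num.max a 0.

Definition is_dist (T : finType) (p : T -> R) : Prop :=
  (forall t, 0 <= p t) /\ \sum_t p t = 1.

Definition is_channel (X T Y : finType) (W : X -> T -> Y -> R) : Prop :=
  forall x t, is_dist (W x t).

Definition blk (n : nat) (A : finType) := {ffun 'I_n -> A}.

Definition chn (X T Y : finType) (W : X -> T -> Y -> R) (n : nat)
  (x : blk n X) (th : blk n T) (y : blk n Y) : R :=
  \prod_(i < n) W (x i) (th i) (y i).

Definition iid (A : finType) (p : A -> R) (n : nat) (a : blk n A) : R :=
  \prod_(i < n) p (a i).

Definition bdist (S : finType) (dS : S -> S -> R) (k : nat) (s sh : blk k S) : R :=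
  (\sum_(i < k) dS (s i) (sh i)) / k%:R.

Definition ball_prob (S : finType) (dS : S -> S -> R) (d : R) (k : nat)
  (PSh : blk k S -> R) (s : blk k S) : R :=
  \sum_(sh : blk k S | bdist dS s sh <= d) PSh sh.

Definition jscc (S X Y : finType) (k n : nat) : finType :=
  ({ffun blk k S -> blk n X} * {ffun blk n Y -> blk k S})%type.

Definition err_th (S X T Y : finType) (W : X -> T -> Y -> R) (PS : S -> R)
  (dS : S -> S -> R) (d : R) (k n : nat) (c : jscc S X Y k n) (th : blk n T) : R :=
  \sum_(s : blk k S) \sum_(y : blk n Y)
    (if d < bdist dS s (c.2 y) then 1 else 0) * iid PS s * chn W (c.1 s) th y.

Definition err (S X T Y : finType) (W : X -> T -> Y -> R) (PS : S -> R)
  (dS : S -> S -> R) (d : R) (k n : nat) (psi : jscc S X Y k n -> R) : R :=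
  \big[Num.max/0]_(th : blk n T)
     \sum_(c : jscc S X Y k n) psi c * err_th W PS dS d c th.

Definition avgW (X T Y : finType) (W : X -> T -> Y -> R) (q : T -> R) (x : X) (y : Y) : R :=
  \sum_t q t * W x t y.

Definition MI (X Y : finType) (P : X -> R) (V : X -> Y -> R) : R :=
  \sum_x \sum_y
    (if P x * V x y == 0 then 0
     else P x * V x y * log2 (V x y / \sum_x' P x' * V x' y)).

Definition capacity (X T Y : finType) (W : X -> T -> Y -> R) : R :=
  sup [set r | exists P : X -> R, is_dist P /\
     r = inf [set v | exists q : T -> R, is_dist q /\ v = MI P (avgW W q)]].

Definition in_Pi (X T Y : finType) (W : X -> T -> Y -> R) (q : T -> R) : Prop :=
  is_dist q /\
  sup [set v | exists P : X -> R, is_dist P /\ v = MI P (avgW W q)] = capacity W.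

Definition qchn (X T Y : finType) (W : X -> T -> Y -> R) (q : T -> R) (n : nat)
  (x : blk n X) (y : blk n Y) : R :=
  \sum_(th : blk n T) iid q th * chn W x th y.

Definition qout (X T Y : finType) (W : X -> T -> Y -> R) (q : T -> R) (n : nat)
  (PX : blk n X -> R) (y : blk n Y) : R :=
  \sum_(x : blk n X) PX x * qchn W q x y.

Definition idens (X T Y : finType) (W : X -> T -> Y -> R) (q : T -> R) (n : nat)
  (PX : blk n X -> R) (x : blk n X) (y : blk n Y) : R :=
  log2 (qchn W q x y / qout W q PX y).

(* exp(-|i(x;y) - log l|^+); when (q* P)(y|x) = 0 we have i = -oo and the value is 1 *)
Definition dterm (X T Y : finType) (W : X -> T -> Y -> R) (q : T -> R) (n : nat)
  (PX : blk n X -> R) (l : nat) (x : blk n X) (y : blk n Y) : R :=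
  if qchn W q x y == 0 then 1
  else exp2 (- pospart (idens W q PX x y - log2 l%:R)).

Definition rseries (u : nat -> R) : R := limn (series u).

Definition is_condL (A : Type) (pL : A -> nat -> R) : Prop :=
  forall a, pL a 0%N = 0 /\ (forall l, 0 <= pL a l) /\
    series (pL a) m @[m --> \oo] --> (1 : R).

Definition term1 (S X T Y : finType) (W : X -> T -> Y -> R) (q : T -> R) (PS : S -> R)
  (k n : nat) (PX : blk n X -> R) (pL : blk k S -> nat -> R) (th : blk n T) : R :=
  \sum_(s : blk k S) iid PS s *
    rseries (fun l => pL s l *
      \sum_(x : blk n X) \sum_(y : blk n Y) PX x * chn W x th y * dterm W q PX l x y).

Definition term2 (S : finType) (PS : S -> R) (dS : S -> S -> R) (d : R) (k : nat)
  (PSh : blk k S -> R) (pL : blk k S -> nat -> R) : R :=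
  \sum_(s : blk k S) iid PS s *
    rseries (fun l => pL s l * (1 - ball_prob dS d PSh s) ^+ l).

End Defs.

(* Main.v *)
(* Draw a codebook of M independent pairs (S_j, X_j) from P_Shat x P_X.  The
   encoder sends X_J, where J is the first index with S_J in the d-ball around
   s.  On output y the decoder picks the index j (counted from 1) maximising
   q*(y|X_j) / j.  The error given J = j, X_j = x and y is, by the union bound,
   at most the sum over k of P(q*(y|X) j / q*(y|x) >= k), hence at most
   j E[q*(y|X)] / q*(y|x) = j exp(-i(x;y)), whatever the
   state sequence.  For every l >= 1 this bounds the error given s by P(J > l) +
   E[min(1, l exp(-i))], which averages over any P_{L|S}.  Finitely many values
   of i occur, so for M large l > M makes the second term 1, and a finite
   codebook serves all l, hence all P_{L|S}, at once. *)

Require Import Defs.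
From HB Require Import structures.
From mathcomp Require Import all_boot all_order all_algebra.
From mathcomp Require Import all_classical all_reals all_analysis.
From mathcomp Require Import zify ring.
Set Implicit Arguments.
Unset Strict Implicit.
Unset Printing Implicit Defensive.

Import Order.TTheory GRing.Theory Num.Theory numFieldNormedType.Exports.
Local Open Scope ring_scope.

(** * Averages over codebooks and over the law of [L] *)

Lemma iid_prod (R : realType) (A : finType) (p : A -> R) (n : nat)
    (F : 'I_n -> A -> R) :
  \sum_(a : blk n A) iid p a * \prod_i F i (a i) =
  \prod_i \sum_x p x * F i x.
Proof.
rewrite bigA_distr_bigA; apply: eq_bigr => a _.
by rewrite /iid -big_split.
Qed.

Lemma iid_ge0 (R : realType) (A : finType) (p : A -> R) (n : nat) (a : blk n A) :
  is_dist p -> 0 <= iid p a.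
Proof. by case=> p0 _; exact: prodr_ge0. Qed.

Lemma is_dist_iid (R : realType) (A : finType) (p : A -> R) (n : nat) :
  is_dist p -> is_dist (iid p (n := n)).
Proof.
move=> dp; split=> [a|]; first exact: iid_ge0.
have := iid_prod p (fun (_ : 'I_n) _ => 1).
rewrite (eq_bigr (iid p (n := n))) => [->|a _]; last by rewrite big1 ?mulr1.
by rewrite big1 // => i _; under eq_bigr do rewrite mulr1; case: dp.
Qed.

Lemma is_dist_chn (R : realType) (X T Y : finType) (W : X -> T -> Y -> R)
    (n : nat) (x : blk n X) (th : blk n T) :
  is_channel W -> is_dist (chn W x th).
Proof.
move=> chW; split=> [y|]; first by apply: prodr_ge0 => i _; case: (chW (x i) (th i)).
rewrite /chn -(bigA_distr_bigA (fun i => W (x i) (th i))) big1 // => i _.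
by case: (chW (x i) (th i)).
Qed.

(** Padding [F] and [G] with the constant [1] at the other coordinates makes [iid_prod] apply. With
    [j] the sent index and [k] a competitor, this is the pairwise independence behind the union
    bound. *)
Lemma iid_marginal2 (R : realType) (A : finType) (p : A -> R) (n : nat)
    (j k : 'I_n) (F G : A -> R) : is_dist p -> k != j ->
  \sum_(a : blk n A) iid p a * (F (a j) * G (a k)) =
  (\sum_x p x * F x) * (\sum_x p x * G x).
Proof.
move=> [_ p1] kj.
pose H i x : R := if i == j then F x else if i == k then G x else 1.
have split2 (B : 'I_n -> R) : (forall i, i != j -> i != k -> B i = 1) ->
    \prod_i B i = B j * B k.
  move=> B1; rewrite (bigD1 j) //= (bigD1 k) //= big1 ?mulr1 // => i /andP[].
  exact: B1.
have Hj x : H j x = F x by rewrite /H eqxx.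
have Hk x : H k x = G x by rewrite /H (negPf kj) eqxx.
have H1 i x : i != j -> i != k -> H i x = 1 by rewrite /H => /negPf-> /negPf->.
transitivity (\sum_(a : blk n A) iid p a * \prod_i H i (a i)).
  by apply: eq_bigr => a _; rewrite split2 ?Hj ?Hk // => i ? ?; rewrite H1.
rewrite iid_prod split2 => [|i ij ik].
  by under eq_bigr do rewrite Hj; under [X in _ * X]eq_bigr do rewrite Hk.
by under eq_bigr do rewrite H1 // mulr1.
Qed.

Lemma iid_marginal (R : realType) (A : finType) (p : A -> R) (n : nat)
    (j : 'I_n) (F : A -> R) : is_dist p ->
  \sum_(a : blk n A) iid p a * F (a j) = \sum_x p x * F x.
Proof.
move=> [_ p1].
pose H i x : R := if i == j then F x else 1.
have split1 (B : 'I_n -> R) : (forall i, i != j -> B i = 1) -> \prod_i B i = B j.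
  by move=> B1; rewrite (bigD1 j) //= big1 ?mulr1.
transitivity (\sum_(a : blk n A) iid p a * \prod_i H i (a i)).
  apply: eq_bigr => a _; rewrite split1 /H ?eqxx // => i /negPf-> //.
rewrite iid_prod split1 /H ?eqxx // => i /negPf->.
by under eq_bigr do rewrite mulr1.
Qed.

(** The indicator factors over the coordinates, those from [l] on contributing [1]. With [B] the
    distortion ball, this produces the power of [1 - ball_prob] in [term2]. *)
Lemma iid_initial_miss (R : realType) (A : finType) (p : A -> R) (n l : nat)
    (B : pred A) : is_dist p -> (l <= n)%N ->
  \sum_(a : blk n A) iid p a * [forall i : 'I_n, (i < l)%N ==> ~~ B (a i)]%:R =
  (1 - \sum_(x | B x) p x) ^+ l.
Proof.
move=> [_ p1] ln.
pose H (i : 'I_n) x : R := if (i < l)%N then (~~ B x)%:R else 1.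
transitivity (\sum_(a : blk n A) iid p a * \prod_i H i (a i)).
  apply: eq_bigr => a _; congr (_ * _); case: forallP => [all|/forallP].
    rewrite big1 // => i _; rewrite /H; case: ifP => // il.
    by rewrite (implyP (all i)).
  rewrite negb_forall => /existsP[i]; rewrite negb_imply negbK => /andP[il Bi].
  by rewrite (bigD1 i) //= /H il Bi mul0r.
rewrite iid_prod.
transitivity (\prod_(i < n) if (i < l)%N then 1 - \sum_(x | B x) p x else 1).
  apply: eq_bigr => i _; rewrite /H; case: ifP => _.
    rewrite -[X in _ = X - _]p1 [X in _ = X - _](bigID B) /=.
    rewrite [RHS]addrC addKr [RHS]big_mkcond /=.
    by apply: eq_bigr => x _; case: (B x); rewrite ?mulr0 ?mulr1.
  by under eq_bigr do rewrite mulr1.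
rewrite -big_mkcond /= -(big_ord_widen n (fun=> 1 - \sum_(x | B x) p x)) //.
by rewrite prodr_const card_ord.
Qed.

(* Summing Markov-type tails exactly, [sum_k 1{k + 1 <= r} <= r], avoids the
   harmonic sum that Markov's inequality applied to each [k] would produce. *)
Lemma sum_nat_le_bound (R : realType) (M : nat) (r : R) : 0 <= r ->
  \sum_(k < M) (k.+1%:R <= r)%R%:R <= r :> R.
Proof.
move=> r0; elim: M => [|M IH]; first by rewrite big_ord0.
rewrite big_ord_recr /=; case: (lerP M.+1%:R r) => [Mr|_]; last by rewrite addr0.
rewrite -natr1 in Mr; apply: le_trans Mr; rewrite lerD2r.
apply: le_trans (_ : \sum_(k < M) 1 <= _).
  by apply: ler_sum => k _; rewrite lern1 leq_b1.
by rewrite sumr_const card_ord.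
Qed.

(** [rseries] is a limit, so convergence has to be secured: factors in [[0, 1]] give it by
    comparison with [series a]. Total mass [1] makes the constant [e] its own average. *)
Lemma rseries_mix_ge (R : realType) (a u v : nat -> R) (e : R) :
  a 0%N = 0 -> (forall l, 0 <= a l) ->
  (series a m @[m --> \oo] --> (1 : R))%classic ->
  (forall l, 0 <= u l <= 1) -> (forall l, 0 <= v l <= 1) ->
  (forall l, (0 < l)%N -> e <= u l + v l) ->
  e <= rseries (fun l => a l * u l) + rseries (fun l => a l * v l).
Proof.
move=> a0 ap acvg u01 v01 euv.
have ca : cvgn (series a) by apply/cvg_ex; exists 1.
have cw w : (forall l, 0 <= w l <= 1) -> cvgn (series (fun l => a l * w l)).
  move=> w01; apply: series_le_cvg ca => // l; have /andP[w0 w1] := w01 l.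
    exact: mulr_ge0.
  by rewrite ler_piMr.
have sae : (series (fun l => a l * e) m @[m --> \oo] --> e)%classic.
  have -> : series (fun l => a l * e) = (fun m => series a m * e).
    by apply/funext => m; rewrite /series /= mulr_suml.
  by rewrite -[X in (_ --> X)%classic]mul1r; apply: cvgMr_tmp.
have <- : limn (series (fun l => a l * e)) = e by exact: cvg_lim.
have sD : series (fun l => a l * u l + a l * v l) =
    (series (fun l => a l * u l) \+ series (fun l => a l * v l)).
  by apply/funext => m; rewrite /series /= big_split.
have -> : rseries (fun l => a l * u l) + rseries (fun l => a l * v l) =
    limn (series (fun l => a l * u l + a l * v l)).
  by rewrite sD limD //; exact: cw.
apply: lim_series_le => [||l].
- by apply/cvg_ex; exists e.
- by rewrite sD; apply: is_cvgD; exact: cw.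
(* The assumed bound says nothing at [l = 0], where the weight vanishes. *)
- case: l => [|l]; first by rewrite a0 !mul0r addr0.
  by rewrite -mulrDr ler_wpM2l // euv.
Qed.

(** * Probability that the decoder confuses codewords *)

Lemma output_prob_gt0 (R : realType) (A : finType) (P V : A -> R) (x : A) :
  is_dist P -> (forall x, 0 <= V x) -> P x != 0 -> V x != 0 ->
  0 < \sum_x' P x' * V x'.
Proof.
move=> [P0 _] V0 Px0 Vx0; have PV0 x' : 0 <= P x' * V x' by exact: mulr_ge0.
rewrite (bigD1 x) //= ltr_pwDl ?sumr_ge0 // lt_neqAle PV0 andbT eq_sym.
by rewrite mulf_neq0.
Qed.

(* Some score [V (c k) / (k + 1)] reaches [V x / (j + 1)], cross-multiplied. *)
Definition confused (R : realType) (A : finType) (M : nat) (V : A -> R)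
    (c : blk M A) (j : 'I_M) (x : A) : bool :=
  [exists k : 'I_M, (k != j) && (V x * k.+1%:R <= V (c k) * j.+1%:R)].

(* [min(1, l exp(-i))] in the paper's notation, with [i = -oo] when [V x = 0]. *)
Definition confusion_bound (R : realType) (A : finType) (P V : A -> R)
    (l : nat) (x : A) : R :=
  if V x == 0 then 1 else Num.min 1 (l%:R * (\sum_x' P x' * V x') / V x).

(** Given [c j = x], the union bound over competitors [k] leaves the events
    [k.+1 <= V x' * j.+1 / V x] for an independent word [x']. Summed over [k], their indicators are
    at most the right-hand ratio, whose mean under [P] is the bound. *)
Lemma confused_pointwise (R : realType) (A : finType) (P V : A -> R) (M : nat)
    (j : 'I_M) (x : A) : is_dist P -> (forall x, 0 <= V x) ->
  \sum_(c : blk M A) iid P c * ((c j == x)%:R * (confused V c j x)%:R) <=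
  P x * confusion_bound P V j.+1 x.
Proof.
move=> dP V0; have [P0 P1] := dP.
have hit : \sum_x' P x' * (x' == x)%:R = P x.
  rewrite (bigD1 x) //= eqxx mulr1 big1 ?addr0 // => x' /negPf->.
  by rewrite mulr0.
(* Forgetting the confusion event leaves the law of [c j]: this is the [1] inside the minimum. *)
have trivial_bound : \sum_(c : blk M A)
    iid P c * ((c j == x)%:R * (confused V c j x)%:R) <= P x.
  rewrite -[leRHS]hit -(iid_marginal j (fun x' => (x' == x)%:R)) //.
  apply: ler_sum => c _; rewrite ler_wpM2l ?iid_ge0 // ler_piMr //.
  by rewrite lern1 leq_b1.
rewrite /confusion_bound; case: eqVneq => [_|Vx0]; first by rewrite mulr1.
have Vx : 0 < V x by rewrite lt_neqAle eq_sym Vx0 V0.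
rewrite minr_pMr // le_min mulr1 trivial_bound /=.
pose E (k : nat) x' : R := (V x * k.+1%:R <= V x' * j.+1%:R)%R%:R.
apply: le_trans (_ : \sum_(k < M | k != j) \sum_(c : blk M A)
    iid P c * ((c j == x)%:R * E k (c k)) <= _).
  rewrite exchange_big /=; apply: ler_sum => c _.
  rewrite -mulr_sumr ler_wpM2l ?iid_ge0 // -mulr_sumr ler_wpM2l //.
  case: (boolP (confused V c j x)) => [/existsP[k /andP[kj le_k]]|_]; last first.
    exact: sumr_ge0.
  by rewrite (bigD1 k) //= /E le_k lerDl sumr_ge0.
rewrite (eq_bigr (fun k : 'I_M => P x * \sum_x' P x' * E k x')); last first.
  by move=> k kj; rewrite (iid_marginal2 (fun x' => (x' == x)%:R) (E k)) ?hit.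
rewrite -mulr_sumr ler_wpM2l //.
(* Restoring the nonnegative term [k = j] gives the full range that [sum_nat_le_bound] expects. *)
apply: le_trans (_ : \sum_(k < M) \sum_x' P x' * E k x' <= _).
  rewrite [leRHS](bigID (fun k => k != j)) /= lerDl.
  by apply: sumr_ge0 => k _; apply: sumr_ge0 => x' _; rewrite mulr_ge0.
rewrite exchange_big /= mulr_sumr mulr_suml; apply: ler_sum => x' _.
rewrite -mulr_sumr [leRHS](_ : _ = P x' * (V x' * j.+1%:R / V x)); last by ring.
rewrite ler_wpM2l //.
have r0 : 0 <= V x' * j.+1%:R / V x by rewrite !mulr_ge0 ?invr_ge0.
apply: le_trans _ (sum_nat_le_bound M r0); rewrite le_eqVlt; apply/orP; left.
by apply/eqP; apply: eq_bigr => k _; rewrite /E ler_pdivlMr // mulrC.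
Qed.

(** The weight [F] stands for the probability of the received output given the sent word. Splitting
    on the value of [c j] reduces to [confused_pointwise]. *)
Lemma confused_avg (R : realType) (A : finType) (P V F : A -> R) (M : nat)
    (j : 'I_M) : is_dist P -> (forall x, 0 <= V x) -> (forall x, 0 <= F x) ->
  \sum_(c : blk M A) iid P c * (F (c j) * (confused V c j (c j))%:R) <=
  \sum_x P x * F x * confusion_bound P V j.+1 x.
Proof.
move=> dP V0 F0.
rewrite (eq_bigr (fun c : blk M A => \sum_x F x *
    (iid P c * ((c j == x)%:R * (confused V c j x)%:R)))); last first.
  move=> c _; rewrite (bigD1 (c j)) //= eqxx mul1r big1 ?addr0.
    by rewrite mulrCA.
  by move=> x; rewrite eq_sym => /negPf->; rewrite mul0r !mulr0.
rewrite exchange_big /=; apply: ler_sum => x _.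
by rewrite -mulr_sumr (mulrC (P x)) -mulrA ler_wpM2l // confused_pointwise.
Qed.

Lemma confusion_bound_le1 (R : realType) (A : finType) (P V : A -> R) l x :
  confusion_bound P V l x <= 1.
Proof. by rewrite /confusion_bound; case: ifP => // _; rewrite ge_min lexx. Qed.

Lemma confusion_bound_ge0 (R : realType) (A : finType) (P V : A -> R) l x :
  is_dist P -> (forall x, 0 <= V x) -> 0 <= confusion_bound P V l x.
Proof.
move=> [P0 _] V0; rewrite /confusion_bound; case: ifP => // _.
rewrite le_min ler01 mulr_ge0 ?invr_ge0 // mulr_ge0 // sumr_ge0 // => x' _.
exact: mulr_ge0.
Qed.

Lemma le_confusion_bound (R : realType) (A : finType) (P V : A -> R) l l' x :
  is_dist P -> (forall x, 0 <= V x) -> (l <= l')%N ->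
  confusion_bound P V l x <= confusion_bound P V l' x.
Proof.
move=> [P0 _] V0 ll'; rewrite /confusion_bound; case: ifP => // _.
rewrite le_min !ge_min lexx /= -!mulrA ler_wpM2r ?orbT ?ler_nat //.
by rewrite mulr_ge0 ?invr_ge0 // sumr_ge0 // => x' _; exact: mulr_ge0.
Qed.

(** There are finitely many likelihood ratios [r x], and any [l] above all of them brings the second
    argument of the minimum to at least [1]. *)
Lemma confusion_bound_saturates (R : realType) (A : finType) (P V : A -> R) :
  is_dist P -> (forall x, 0 <= V x) ->
  exists M : nat, forall l x, (M <= l)%N -> P x != 0 -> confusion_bound P V l x = 1.
Proof.
move=> dP V0; pose r x := V x / \sum_x' P x' * V x'.
exists (\max_x Num.bound (r x)) => l x Ml Px0.
rewrite /confusion_bound; case: eqVneq => // Vx0; apply/min_idPl.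
have Vx : 0 < V x by rewrite lt_neqAle eq_sym Vx0 V0.
have out := output_prob_gt0 dP V0 Px0 Vx0.
rewrite ler_pdivlMr // mul1r -ler_pdivrMr // -/(r x).
have r0 : 0 <= r x by rewrite divr_ge0 // ltW.
apply: le_trans (ltW (archi_boundP r0)) _; rewrite ler_nat.
by apply: leq_trans Ml; rewrite (@leq_bigmax _ (fun x => Num.bound (r x))).
Qed.

(** * Link with the information density *)

Lemma qchn_ge0 (R : realType) (X T Y : finType) (W : X -> T -> Y -> R)
    (q : T -> R) (n : nat) (x : blk n X) (y : blk n Y) :
  is_channel W -> is_dist q -> 0 <= qchn W q x y.
Proof.
move=> chW dq; apply: sumr_ge0 => th _; rewrite mulr_ge0 ?iid_ge0 //.
by case: (is_dist_chn x th chW).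
Qed.

(** With [z] equal to [exp(i) / l], the identity is [exp(-|log z|^+) = min(1, 1/z)]. [PX x != 0] and
    [0 < l] keep the arguments of the logarithms positive. *)
Lemma dtermE (R : realType) (X T Y : finType) (W : X -> T -> Y -> R) (q : T -> R)
    (n : nat) (PX : blk n X -> R) (l : nat) (x : blk n X) (y : blk n Y) :
  is_channel W -> is_dist q -> is_dist PX -> PX x != 0 -> (0 < l)%N ->
  dterm W q PX l x y = confusion_bound PX (fun x => qchn W q x y) l x.
Proof.
move=> chW dq dP Px0 l0; rewrite /dterm /confusion_bound.
case: eqVneq => // Vx0.
have V0 x' : 0 <= qchn W q x' y by exact: qchn_ge0.
have Vx : 0 < qchn W q x y by rewrite lt_neqAle eq_sym Vx0 V0.
have out : 0 < qout W q PX y by exact: output_prob_gt0 dP V0 Px0 Vx0.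
have lR : 0 < l%:R :> R by rewrite ltr0n.
have ln2 : 0 < ln 2 :> R by rewrite ln_gt0 ?ltr1n.
rewrite -/(qout W q PX y) /exp2 /pospart /idens /log2.
have -> : ln (qchn W q x y / qout W q PX y) / ln 2 - ln l%:R / ln 2 =
    ln (qchn W q x y / (l%:R * qout W q PX y)) / ln 2.
  rewrite !ln_div ?posrE ?mulr_gt0 // lnM ?posrE //; ring.
set z := qchn W q x y / (l%:R * qout W q PX y).
have z0 : 0 < z by rewrite divr_gt0 ?mulr_gt0.
have -> : l%:R * qout W q PX y / qchn W q x y = z^-1 by rewrite invf_div.
rewrite mulNr maxr_pMl ?ltW // mul0r divfK ?gt_eqF //.
rewrite expRN; case: (leP 1 z) => z1.
  rewrite max_l ?ln_ge0 // lnK ?posrE // min_r // invf_le1 //.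
by rewrite max_r ?ln_le0 ?expR0 ?invr1 1?ltW // min_l // invf_ge1 // ltW.
Qed.

(** * The random code *)

(* A minimiser of the index, where misses are penalised beyond every index. *)
Definition first_hit (A : finType) (M : nat) (B : pred A) (c : blk M.+1 A) :
    'I_M.+1 :=
  [arg min_(j < ord0) (j + M.+1 * ~~ B (c j))%N].

Lemma first_hitP (A : finType) (M : nat) (B : pred A) (c : blk M.+1 A)
    (i : 'I_M.+1) :
  B (c i) -> B (c (first_hit B c)) /\ (first_hit B c <= i)%N.
Proof.
rewrite /first_hit; case: arg_minnP => // j _ /(_ i isT) + Bi.
by rewrite Bi; have := ltn_ord i; case: (B (c j)) => /=; lia.
Qed.

Definition best_index (R : realType) (A : finType) (M : nat) (V : A -> R)
    (c : blk M.+1 A) : 'I_M.+1 :=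
  [arg max_(j > ord0) (V (c j) / j.+1%:R)]%O.

(** [confused] uses a non-strict comparison, so ties count as confusion and whichever maximiser is
    returned must be [j]. *)
Lemma best_indexP (R : realType) (A : finType) (M : nat) (V : A -> R)
    (c : blk M.+1 A) (j : 'I_M.+1) :
  ~~ confused V c j (c j) -> best_index V c = j.
Proof.
rewrite /best_index; case: arg_maxP => // k _ /(_ j isT) le_jk.
apply: contraNeq => kj; apply/existsP; exists k; rewrite kj /=.
by rewrite -ler_pdivrMr // mulrAC -ler_pdivlMr.
Qed.

(** The decoder scores with the [q]-averaged channel, so the code does not depend on the state
    sequence. *)
Definition book_code (R : realType) (S X T Y : finType) (k n M : nat)
    (W : X -> T -> Y -> R) (dS : S -> S -> R) (d : R) (q : T -> R)
    (b : blk M.+1 (blk k S) * blk M.+1 (blk n X)) : jscc S X Y k n :=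
  ([ffun s => b.2 (first_hit (fun sh => bdist dS s sh <= d) b.1)],
   [ffun y => b.1 (best_index (fun x => qchn W q x y) b.2)]).

Definition book_prob (R : realType) (S X : finType) (k n M : nat)
    (PSh : blk k S -> R) (PX : blk n X -> R)
    (b : blk M.+1 (blk k S) * blk M.+1 (blk n X)) : R :=
  iid PSh b.1 * iid PX b.2.

Definition pushforward (R : realType) (A B : finType) (P : A -> R) (f : A -> B)
    (b : B) : R :=
  \sum_(a | f a == b) P a.

Lemma pushforward_avg (R : realType) (A B : finType) (P : A -> R) (f : A -> B)
    (F : B -> R) :
  \sum_b pushforward P f b * F b = \sum_a P a * F (f a).
Proof.
rewrite [RHS](partition_big f predT) //=; apply: eq_bigr => b _.
by rewrite mulr_suml; apply: eq_bigr => a /eqP->.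
Qed.

Lemma is_dist_pushforward (R : realType) (A B : finType) (P : A -> R)
    (f : A -> B) : is_dist P -> is_dist (pushforward P f).
Proof.
move=> [P0 P1]; split=> [b|]; first exact: sumr_ge0.
have := pushforward_avg P f (fun=> 1).
by under eq_bigr do rewrite mulr1; under [RHS]eq_bigr do rewrite mulr1; rewrite P1.
Qed.

Lemma is_dist_book_prob (R : realType) (S X : finType) (k n M : nat)
    (PSh : blk k S -> R) (PX : blk n X -> R) :
  is_dist PSh -> is_dist PX -> is_dist (book_prob PSh PX (M := M)).
Proof.
move=> dPSh dPX; split=> [b|]; first by rewrite mulr_ge0 ?iid_ge0.
rewrite -(pair_bigA _ (fun cS cX => iid PSh cS * iid PX cX)) /=.
under eq_bigr do rewrite -mulr_sumr.
by rewrite -mulr_suml !(is_dist_iid _ _).2 ?mulr1.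
Qed.

(** * Error for one source word *)

Definition channel_loss (R : realType) (X T Y : finType) (W : X -> T -> Y -> R)
    (q : T -> R) (n : nat) (PX : blk n X -> R) (th : blk n T) (l : nat) : R :=
  \sum_x \sum_y PX x * chn W x th y * confusion_bound PX (fun x => qchn W q x y) l x.

Definition source_err (R : realType) (S X T Y : finType) (W : X -> T -> Y -> R)
    (dS : S -> S -> R) (d : R) (k n : nat) (c : jscc S X Y k n) (th : blk n T)
    (s : blk k S) : R :=
  \sum_y (d < bdist dS s (c.2 y))%R%:R * chn W (c.1 s) th y.

Lemma err_thE (R : realType) (S X T Y : finType) (W : X -> T -> Y -> R)
    (PS : S -> R) (dS : S -> S -> R) (d : R) (k n : nat) (c : jscc S X Y k n)
    (th : blk n T) :
  err_th W PS dS d c th = \sum_s iid PS s * source_err W dS d c th s.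
Proof.
apply: eq_bigr => s _; rewrite mulr_sumr; apply: eq_bigr => y _.
by rewrite mulrA (mulrC (iid PS s)); case: ifP.
Qed.

Lemma source_err_le1 (R : realType) (S X T Y : finType) (W : X -> T -> Y -> R)
    (dS : S -> S -> R) (d : R) (k n : nat) (c : jscc S X Y k n) (th : blk n T)
    (s : blk k S) : is_channel W -> source_err W dS d c th s <= 1.
Proof.
move=> chW; have [W0 W1] := is_dist_chn (c.1 s) th chW.
rewrite -W1; apply: ler_sum => y _.
by rewrite ler_piMl // lern1 leq_b1.
Qed.

Lemma ball_prob_itv (R : realType) (S : finType) (dS : S -> S -> R) (d : R)
    (k : nat) (PSh : blk k S -> R) (s : blk k S) :
  is_dist PSh -> 0 <= 1 - ball_prob dS d PSh s <= 1.
Proof.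
move=> [P0 P1]; rewrite subr_ge0 gerBl sumr_ge0 // andbT.
rewrite -P1 /ball_prob [leRHS](bigID (fun sh => bdist dS s sh <= d)) /=.
by rewrite lerDl sumr_ge0.
Qed.

Section CodingLemma.
Context (R : realType) (S X T Y : finType) (k n M : nat).
Context (W : X -> T -> Y -> R) (dS : S -> S -> R) (d : R).
Context (PX : blk n X -> R) (PSh : blk k S -> R) (q : T -> R).
Hypotheses (chW : is_channel W) (dq : is_dist q) (dPX : is_dist PX)
  (dPSh : is_dist PSh).

Let code := @book_code R S X T Y k n M W dS d q.
Let loss := channel_loss W q PX.
Let V0 (y : blk n Y) (x : blk n X) : 0 <= qchn W q x y := qchn_ge0 x y chW dq.
Let W0 (x : blk n X) (th : blk n T) (y : blk n Y) : 0 <= chn W x th y :=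
  (is_dist_chn x th chW).1 y.

Lemma channel_loss_ge0 th l : 0 <= loss th l.
Proof.
apply: sumr_ge0 => x _; apply: sumr_ge0 => y _.
by rewrite !mulr_ge0 ?confusion_bound_ge0 //; exact: dPX.1.
Qed.

Lemma channel_loss_le1 th l : loss th l <= 1.
Proof.
rewrite -dPX.2; apply: ler_sum => x _.
rewrite -[leRHS]mulr1 -(is_dist_chn x th chW).2 mulr_sumr; apply: ler_sum => y _.
by rewrite ler_piMr ?confusion_bound_le1 // mulr_ge0 //; exact: dPX.1.
Qed.

Lemma le_channel_loss th l l' : (l <= l')%N -> loss th l <= loss th l'.
Proof.
move=> ll'; apply: ler_sum => x _; apply: ler_sum => y _.
by rewrite ler_wpM2l ?le_confusion_bound // mulr_ge0 //; exact: dPX.1.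
Qed.

(** The source codebook is held fixed. Since [cS j] is within distortion, an error forces the
    decoder to an index other than [j], hence [confused], and only the channel codebook is
    averaged. *)
Lemma source_err_hit (cS : blk M.+1 (blk k S)) th s :
  let j := first_hit (fun sh => bdist dS s sh <= d) cS in
  bdist dS s (cS j) <= d ->
  \sum_cX iid PX cX * source_err W dS d (code (cS, cX)) th s <= loss th j.+1.
Proof.
move=> j hit.
apply: le_trans (_ : \sum_y \sum_(cX : blk M.+1 (blk n X)) iid PX cX *
    (chn W (cX j) th y * (confused (fun x => qchn W q x y) cX j (cX j))%:R) <= _).
  rewrite exchange_big; apply: ler_sum => cX _; rewrite -mulr_sumr.
  rewrite ler_wpM2l ?iid_ge0 //; apply: ler_sum => y _.
  rewrite !ffunE /= -/j mulrC ler_wpM2l // ler_nat.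
  case: (boolP (confused _ _ _ _)) => [_|/best_indexP->]; first exact: leq_b1.
  by rewrite ltNge hit.
rewrite /loss /channel_loss [leRHS]exchange_big; apply: ler_sum => y _.
exact: confused_avg.
Qed.

(** For [l <= M], split on whether the first [l] source words all miss the ball: a miss is charged
    to the ball term, a hit to the loss. For larger [l] the loss is already [1]. *)
Lemma source_err_avg th s l :
  (forall l' y x, (M <= l')%N -> PX x != 0 ->
    confusion_bound PX (fun x => qchn W q x y) l' x = 1) ->
  \sum_b book_prob PSh PX b * source_err W dS d (code b) th s <=
  loss th l + (1 - ball_prob dS d PSh s) ^+ l.
Proof.
move=> sat; have [lM|Ml] := leqP l M; last first.
  apply: le_trans (_ : 1 <= _).
    rewrite -(is_dist_book_prob M dPSh dPX).2; apply: ler_sum => b _.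
    rewrite ler_piMr ?source_err_le1 //.
    exact: (is_dist_book_prob M dPSh dPX).1.
  have /andP[p0 _] := ball_prob_itv dS d s dPSh.
  rewrite ler_wpDr ?exprn_ge0 //.
  rewrite -dPX.2; apply: ler_sum => x _.
  have [->|Px0] := eqVneq (PX x) 0.
    by rewrite sumr_ge0 // => y _; rewrite !mul0r.
  rewrite -[leLHS]mulr1 -(is_dist_chn x th chW).2 mulr_sumr.
  by apply: ler_sum => y _; rewrite sat ?mulr1 // ltnW.
rewrite -(pair_bigA _ (fun cS cX => book_prob PSh PX (cS, cX) *
  source_err W dS d (code (cS, cX)) th s)) /=.
(* Both terms on the right become averages over source codebooks, to be compared codebook by
   codebook. *)
rewrite -(iid_initial_miss _ dPSh (leqW lM)) -[loss th l]mul1r.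
rewrite -[X in X * loss th l](is_dist_iid M.+1 dPSh).2 mulr_suml -big_split /=.
apply: ler_sum => cS _; rewrite -mulrDr.
under eq_bigr do rewrite /book_prob /= -mulrA.
rewrite -mulr_sumr ler_wpM2l ?iid_ge0 //.
case: (boolP [forall i, _]) => [_|].
  (* All of the first [l] words miss: the indicator is [1] and alone covers the error. *)
  apply: ler_wpDl; first exact: channel_loss_ge0.
  rewrite -[leRHS](is_dist_iid M.+1 dPX).2; apply: ler_sum => cX _.
  by rewrite ler_piMr ?iid_ge0 ?source_err_le1.
rewrite negb_forall => /existsP[i]; rewrite negb_imply negbK => /andP[il hit].
have [hit1 le_i] := first_hitP (B := fun sh => bdist dS s sh <= d) hit.
rewrite addr0; apply: le_trans (source_err_hit th hit1) _.
(* Indices start at [0]: a hit at [i < l] puts the first hit at most at [i], so its successor is at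
   most [l]. *)
by apply: le_channel_loss; apply: leq_ltn_trans il.
Qed.

End CodingLemma.

Theorem theorem6 (R : realType) (S X T Y : finType) (k n : nat)
  (W : X -> T -> Y -> R) (PS : S -> R) (dS : S -> S -> R) (d : R)
  (PX : blk n X -> R) (PSh : blk k S -> R) (q : T -> R) :
  is_channel W -> is_dist PS -> is_dist PX -> is_dist PSh -> in_Pi W q ->
  exists psi : jscc S X Y k n -> R, is_dist psi /\
    forall pL : blk k S -> nat -> R, is_condL pL ->
      err W PS dS d psi <=
      \big[Num.max/0]_(th : blk n T)
         (term1 W q PS PX pL th + term2 PS dS d PSh pL).
Proof.
move=> chW dPS dPX dPSh [dq _].
have V0 (y : blk n Y) (x : blk n X) : 0 <= qchn W q x y := qchn_ge0 x y chW dq.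
have /choice[Msat sat] : forall y : blk n Y, exists M : nat, forall l x,
    (M <= l)%N -> PX x != 0 ->
    confusion_bound PX (fun x => qchn W q x y) l x = 1.
  by move=> y; exact: confusion_bound_saturates.
(* The maximum over outputs gives one saturation threshold for all [y]. *)
pose M := \max_y Msat y.
have satM l y x : (M <= l)%N -> PX x != 0 ->
    confusion_bound PX (fun x => qchn W q x y) l x = 1.
  by move=> Ml; apply: sat; apply: leq_trans Ml; exact: leq_bigmax.
(* The law of the code is fixed before [pL] is introduced, so one code serves every [pL]. *)
exists (pushforward (book_prob PSh PX) (@book_code R S X T Y k n M W dS d q)).
split; first exact/is_dist_pushforward/is_dist_book_prob.
move=> pL condL; apply: le_bigmax2 => th _.
rewrite pushforward_avg /term1 /term2 -big_split /=.
under eq_bigr do rewrite err_thE mulr_sumr.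
rewrite exchange_big; apply: ler_sum => s _ /=; rewrite -mulrDr.
under eq_bigr do rewrite mulrCA.
rewrite -mulr_sumr ler_wpM2l ?iid_ge0 //.
have [pL0 [pLge0 pL1]] := condL s.
(* [dtermE] requires [0 < l] and [PX x != 0]; the excluded cases carry zero weight. *)
rewrite (_ : (fun l => pL s l * _) =
    (fun l => pL s l * channel_loss W q PX th l)); last first.
  apply/funext => -[|l]; first by rewrite pL0 !mul0r.
  congr (_ * _); apply: eq_bigr => x _; apply: eq_bigr => y _.
  have [->|Px0] := eqVneq (PX x) 0; first by rewrite !mul0r.
  by rewrite dtermE.
apply: rseries_mix_ge => // l.
- by rewrite channel_loss_ge0 ?channel_loss_le1.
- by have /andP[p0 p1] := ball_prob_itv dS d s dPSh; rewrite exprn_ge0 ?exprn_ile1.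
- by move=> _; exact: source_err_avg.
Qed.
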